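(* Let $I$ be a monomial ideal in $S$. If $\{(\mathbf{x}^{\mathbf{u}_i},\sigma_i) : 1\le i\le m\}$ is a Stanley filtration for $S/I$, then $$\bigcap_{i=1}^{m}\bigl(A\mathbf{u}_i+\operatorname{reg}(S_{\sigma_i})\bigr)\subseteq \operatorname{reg}(S/I).$$ In addition, if $I$ is $B$-saturated, then the intersection can be taken over only those pairs $(\mathbf{x}^{\mathbf{u}_i},\sigma_i)$ such that $\widehat{\sigma}_i\in\Delta$; that is, $$\bigcap_{i\,:\,\widehat{\sigma}_i\in\Delta}\bigl(A\mathbf{u}_i+\operatorname{reg}(S_{\sigma_i})\bigr)\subseteq \operatorname{reg}(S/I).$$
   Context: Setting. $X$ is a smooth projective toric variety of dimension $d$ over a field $\Bbbk$ determined by a fan $\Delta$ in $\mathbb{R}^d$. The rays of the fan are numbered $1,\dots,n$, with minimal lattice generators $\mathbf{b}_1,\dots,\mathbf{b}_n$ (spanning $\mathbb{R}^d$), and $\Delta$ is identified with a simplicial complex on $[n]=\{1,\dots,n\}$ ($\sigma\in\Delta$ iff the rays indexed by $\sigma$ span a cone of the fan). Put $r=n-d$ and fix an integer $r\times n$ matrix $A=[\mathbf{a}_1\cdots\mathbf{a}_n]$ such that $0\to\mathbb{Z}^d\xrightarrow{[\mathbf{b}_1\cdots\mathbf{b}_n]^{T}}\mathbb{Z}^n\xrightarrow{A}\mathbb{Z}^r\to0$ is exact. $S=\Bbbk[x_1,\dots,x_n]$ is $\mathbb{Z}^r$-graded by $\deg(x_i)=\mathbf{a}_i$, so $\deg(\mathbf{x}^{\mathbf{u}})=A\mathbf{u}$.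 The irrelevant ideal is $B=\langle\prod_{i\notin\sigma}x_i:\sigma\in\Delta\rangle$. For $\sigma\subseteq[n]$, $\widehat\sigma=[n]\setminus\sigma$ and $\mathbb{N}A_\sigma$ is the semigroup generated by $\{\mathbf{a}_i:i\in\sigma\}$. Let $\mathcal{K}=\bigcap_{\sigma\in\Delta}\mathbb{N}A_{\widehat\sigma}$, with unique minimal Hilbert basis (minimal generating set as a semigroup) $\mathbf{c}_1,\dots,\mathbf{c}_e$. An ideal $I$ is $B$-saturated if $(I:B^\infty)=I$. For $\sigma\subseteq[n]$, $S_\sigma=\Bbbk[x_i:i\in\sigma]$, regarded as the $S$-module $S/\langle x_i:i\notin\sigma\rangle$. Multigraded regularity. A finitely generated $\mathbb{Z}^r$-graded $S$-module $M$ is $\mathbf{k}$-regular ($\mathbf{k}\in\mathbb{Z}^r$) if: (1) $H^i_B(M)_{\mathbf{p}}=0$ for all $i\ge1$ and all $\mathbf{p}\in\bigcup(\mathbf{k}-\lambda_1\mathbf{c}_1-\dots-\lambda_e\mathbf{c}_e+\mathcal{K})$, the union over all $\lambda_1,\dots,\lambda_e\in\mathbb{N}$ with $\lambda_1+\dots+\lambda_e=i-1$; and (2) $H^0_B(M)_{\mathbf{p}}=0$ for all $\mathbf{p}\in\bigcup_{1\le j\le e}(\mathbf{k}+\mathbf{c}_j+\mathcal{K})$. Here $H^i_B$ is local cohomology. $\operatorname{reg}(M)=\{\mathbf{k}\in\mathbb{Z}^r: M\text{ is }\mathbf{k}\text{-regular}\}$. Stanley filtrations. A pair $(\mathbf{x}^{\mathbf{u}},\sigma)$,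 with $\mathbf{x}^{\mathbf u}$ a monomial of $S$ and $\sigma\subseteq[n]$, denotes the set of monomials $\mathbf{x}^{\mathbf{u}+\mathbf{v}}$ with $\{i:v_i\ne0\}\subseteq\sigma$. A Stanley decomposition for $S/I$ ($I$ a monomial ideal) is a finite set of pairs such that the monomials of $S$ not in $I$ are the disjoint union of the sets $(\mathbf{x}^{\mathbf{u}},\sigma)$ in it. A Stanley filtration for $S/I$ is a Stanley decomposition with an ordering $\{(\mathbf{x}^{\mathbf{u}_i},\sigma_i):1\le i\le m\}$ such that for all $1\le j\le m$ the set $\{(\mathbf{x}^{\mathbf{u}_i},\sigma_i):1\le i\le j\}$ is a Stanley decomposition for $S/(I+\langle\mathbf{x}^{\mathbf{u}_{j+1}},\dots,\mathbf{x}^{\mathbf{u}_m}\rangle)$. *)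

(* Defs.v *)
From HB Require Import structures.
From mathcomp Require Import all_boot all_order all_algebra.
From mathcomp Require Import boolp reals.
From mathcomp Require Import mpoly zify ring.

Set Implicit Arguments.
Unset Strict Implicit.
Unset Printing Implicit Defensive.

Import Order.TTheory GRing.Theory Num.Theory.
Local Open Scope ring_scope.
Local Open Scope quotient_scope.

(* Ideals are Prop-valued and may be the whole ring, unlike the library's
   [idealr], which is restricted to proper ideals. *)
Record ideal (S : comNzRingType) := Ideal {
  ideal_mem :> S -> Prop;
  ideal_mem0 : ideal_mem 0;
  ideal_memD : forall f g, ideal_mem f -> ideal_mem g -> ideal_mem (f + g);
  ideal_memM : forall f g, ideal_mem g -> ideal_mem (f * g) }.

Section Ideals.
Variable S : comNzRingType.
Implicit Types (I J : ideal S) (G : S -> Prop).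

Definition lincomb G (f : S) : Prop :=
  exists s : seq (S * S),
    (forall x, x \in s -> G x.2) /\ f = \sum_(x <- s) x.1 * x.2.

Lemma lincomb0 G : lincomb G 0.
Proof. by exists [::]; split => //; rewrite big_nil. Qed.

Lemma lincombD G f g : lincomb G f -> lincomb G g -> lincomb G (f + g).
Proof.
move=> [s [Gs ->]] [t [Gt ->]]; exists (s ++ t); rewrite big_cat; split => // x.
by rewrite mem_cat => /orP[/Gs|/Gt].
Qed.

Lemma lincombM G f g : lincomb G g -> lincomb G (f * g).
Proof.
move=> [s [Gs ->]]; exists [seq (f * x.1, x.2) | x <- s]; split.
  by move=> x /mapP[y /Gs Gy ->].
by rewrite big_map mulr_sumr; apply: eq_bigr => x _; rewrite mulrA.
Qed.

Definition ideal_gen G : ideal S :=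
  Ideal (@lincomb0 G) (@lincombD G) (@lincombM G).

Definition ideal_add I G : ideal S := ideal_gen (fun f => I f \/ G f).

Definition ideal_exp I (t : nat) : ideal S :=
  ideal_gen (fun f => exists s : seq S,
    [/\ size s = t, forall g, g \in s -> I g & f = \prod_(g <- s) g]).

Definition saturation I J (f : S) : Prop :=
  exists t : nat, forall g, ideal_exp J t g -> I (f * g).

Definition saturated I J : Prop := forall f, saturation I J f <-> I f.

Definition ideal_pred I : S -> bool := fun f => `[< I f >].

Lemma ideal_pred_zmod I : zmod_closed (ideal_pred I).
Proof.
split; first by apply/asboolP; exact: ideal_mem0.
move=> f g /asboolP If /asboolP Ig; apply/asboolP.
by rewrite -mulN1r; apply: ideal_memD => //; apply: ideal_memM.
Qed.

HB.instance Definition _ I :=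
  GRing.isZmodClosed.Build S (ideal_pred I) (ideal_pred_zmod I).

Definition quot_mod I :=
  {ideal_quot (GRing.ZmodClosed.clone S (ideal_pred I) _)}.
HB.instance Definition _ I := GRing.Zmodule.on (quot_mod I).
HB.instance Definition _ I := EqQuotient.on (quot_mod I).

Definition to_quot I (f : S) : quot_mod I := \pi_(quot_mod I) f.

Lemma to_quotE I f g : to_quot I f = to_quot I g <-> I (f - g).
Proof.
split.
  by move/eqP; rewrite /to_quot -ring_quotient.Quotient.idealrBE => /asboolP.
move=> Ifg; apply/eqP.
by rewrite /to_quot -ring_quotient.Quotient.idealrBE; apply/asboolP.
Qed.

Lemma to_quotD I : {morph @to_quot I : f g / f + g}.
Proof. by move=> f g; rewrite /to_quot raddfD. Qed.

Definition quot_scale I (f : S) (x : quot_mod I) : quot_mod I :=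
  to_quot I (f * repr x).

Lemma to_quotK I (x : quot_mod I) : to_quot I (repr x) = x.
Proof. exact: reprK. Qed.

Lemma quot_scaleE I f g : quot_scale f (to_quot I g) = to_quot I (f * g).
Proof.
apply/to_quotE; rewrite -mulrBr; apply: ideal_memM.
by apply/to_quotE; rewrite to_quotK.
Qed.

Fact quot_scaleA I f g (x : quot_mod I) :
  quot_scale f (quot_scale g x) = quot_scale (f * g) x.
Proof. by rewrite -[x]to_quotK !quot_scaleE mulrA. Qed.

Fact quot_scale1 I : left_id 1 (@quot_scale I).
Proof. by move=> x; rewrite -[x]to_quotK quot_scaleE mul1r. Qed.

Fact quot_scaleDr I : right_distributive (@quot_scale I) +%R.
Proof.
move=> f x y; rewrite -[x]to_quotK -[y]to_quotK -to_quotD.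
by rewrite !quot_scaleE mulrDr to_quotD.
Qed.

Fact quot_scaleDl I (x : quot_mod I) :
  {morph (@quot_scale I)^~ x : f g / f + g}.
Proof.
by move=> f g; rewrite -[x]to_quotK !quot_scaleE mulrDl to_quotD.
Qed.

HB.instance Definition _ I := GRing.Zmodule_isLmodule.Build S (quot_mod I)
  (@quot_scaleA I) (@quot_scale1 I) (@quot_scaleDr I) (@quot_scaleDl I).

End Ideals.

Section Localization.
Variables (S : comNzRingType) (M : lmodType S) (f : S).

(* The pair (m, t) stands for the fraction m / f^t. *)
Definition loc_eq (x y : M * nat) : bool :=
  `[< exists t : nat, f ^+ t *: (f ^+ y.2 *: x.1 - f ^+ x.2 *: y.1) = 0 >].

Lemma loc_eq_refl : reflexive loc_eq.
Proof. by move=> x; apply/asboolP; exists 0%N; rewrite subrr scaler0. Qed.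

Lemma loc_eq_sym : ssrbool.symmetric loc_eq.
Proof.
move=> x y; apply: asbool_equiv_eq; split=> -[t e]; exists t.
  by rewrite -opprB scalerN e oppr0.
by rewrite -opprB scalerN e oppr0.
Qed.

Lemma loc_eq_trans : transitive loc_eq.
Proof.
move=> y x z /asboolP[t e] /asboolP[s e']; apply/asboolP.
exists (t + s + y.2)%N.
have -> : f ^+ (t + s + y.2) *: (f ^+ z.2 *: x.1 - f ^+ x.2 *: z.1)
  = f ^+ (s + z.2) *: (f ^+ t *: (f ^+ y.2 *: x.1 - f ^+ x.2 *: y.1))
    + f ^+ (t + x.2) *: (f ^+ s *: (f ^+ z.2 *: y.1 - f ^+ y.2 *: z.1)).
  rewrite !scalerBr !scalerA -!exprD addrA.
  have -> : (s + z.2 + t + x.2 = t + x.2 + s + z.2)%N by lia.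
  by rewrite subrK; congr (_ ^+ _ *: _ - _ ^+ _ *: _); lia.
by rewrite e e' !scaler0 addr0.
Qed.

Canonical loc_equiv := EquivRel loc_eq loc_eq_refl loc_eq_sym loc_eq_trans.
Canonical loc_encModRel := defaultEncModRel loc_eq.

Definition loc := {eq_quot loc_eq}.
HB.instance Definition _ : EqQuotient (M * nat)%type loc_eq loc :=
  EqQuotient.on loc.
HB.instance Definition _ := Choice.on loc.

Definition frac (m : M) (t : nat) : loc := \pi_loc (m, t).

Lemma frac_eq m s m' s' : frac m s = frac m' s' <->
  exists t : nat, f ^+ t *: (f ^+ s' *: m - f ^+ s *: m') = 0.
Proof.
split; first by move/eqP; rewrite /frac piE => /asboolP.
by move=> h; apply/eqP; rewrite /frac piE; apply/asboolP.
Qed.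

Lemma fracK (x : loc) : frac (repr x).1 (repr x).2 = x.
Proof. by rewrite /frac -surjective_pairing reprK. Qed.

Definition loc_zero : loc := frac 0 0.
Definition loc_opp (x : loc) : loc := frac (- (repr x).1) (repr x).2.
Definition loc_add (x y : loc) : loc :=
  frac (f ^+ (repr y).2 *: (repr x).1 + f ^+ (repr x).2 *: (repr y).1)
       ((repr x).2 + (repr y).2).

Lemma loc_oppE m t : loc_opp (frac m t) = frac (- m) t.
Proof.
have /frac_eq[k e] := fracK (frac m t); apply/frac_eq; exists k.
by rewrite !scalerN -opprD scalerN e oppr0.
Qed.

Lemma loc_addE m s m' s' : loc_add (frac m s) (frac m' s') =
  frac (f ^+ s' *: m + f ^+ s *: m') (s + s').
Proof.
rewrite /loc_add.
have /frac_eq[k] := fracK (frac m s); have /frac_eq[k'] := fracK (frac m' s').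
move: (repr _) (repr _) => [n t] [n' t'] /= e' e; apply/frac_eq.
exists (k + k')%N.
transitivity (f ^+ (k' + s' + t') *: (f ^+ k *: (f ^+ s *: n - f ^+ t *: m))
  + f ^+ (k + s + t) *: (f ^+ k' *: (f ^+ s' *: n' - f ^+ t' *: m'))).
  rewrite !(scalerBr, scalerDr) !scalerA -!exprD opprD addrACA.
  by congr (_ ^+ _ *: _ - _ ^+ _ *: _ + (_ ^+ _ *: _ - _ ^+ _ *: _)); lia.
by rewrite e e' !scaler0 addr0.
Qed.

Fact loc_addA : associative loc_add.
Proof.
move=> x y z; rewrite -(fracK x) -(fracK y) -(fracK z) !loc_addE.
rewrite addnA; congr frac.
rewrite !scalerDr !scalerA -!exprD addrA.
by congr (_ ^+ _ *: _ + _ ^+ _ *: _ + _ ^+ _ *: _); lia.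
Qed.

Fact loc_addC : commutative loc_add.
Proof. by move=> x y; rewrite /loc_add addrC addnC. Qed.

Fact loc_add0 : left_id loc_zero loc_add.
Proof.
by move=> x; rewrite -(fracK x) loc_addE scaler0 add0r expr0 scale1r.
Qed.

Fact loc_addN : left_inverse loc_zero loc_opp loc_add.
Proof.
move=> x; rewrite -(fracK x) loc_oppE loc_addE scalerN addNr.
by apply/frac_eq; exists 0%N; rewrite !scaler0 subrr scaler0.
Qed.

HB.instance Definition _ :=
  GRing.isZmodule.Build loc loc_addA loc_addC loc_add0 loc_addN.

End Localization.

Arguments loc {S} M f.
Arguments frac {S M f} m t.

(* The canonical map M_f -> M_(g * f), m / f^t |-> (g^t m) / (g f)^t; the
   target is given by h, to be used with h = g * f. *)
Definition loc_map (S : comNzRingType) (M : lmodType S) (f h g : S)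
    (x : loc M f) : loc M h :=
  frac (g ^+ (repr x).2 *: (repr x).1) (repr x).2.

Lemma loc_mapE (S : comNzRingType) (M : lmodType S) (f h g : S) m t :
  h = g * f -> loc_map h g (frac m t : loc M f) = frac (g ^+ t *: m) t.
Proof.
move=> ->; rewrite /loc_map.
have /frac_eq[k] := fracK (frac m t : loc M f).
move: (repr _) => [n s] /= e; apply/frac_eq; exists k.
transitivity (g ^+ (k + s + t) *: (f ^+ k *: (f ^+ t *: n - f ^+ s *: m))).
  rewrite !scalerBr !scalerA !exprMn.
  congr (_ *: _ - _ *: _).
    by rewrite !exprD; ring.
  by rewrite !exprD; ring.
by rewrite e scaler0.
Qed.

Section ToricData.
Variables (n d : nat) (b : 'M[int]_(n, d)) (Delta : {set {set 'I_n}}).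

(* The i-th row of b is the lattice generator b_i of the i-th ray. *)
Definition in_cone (R : realType) (sigma : {set 'I_n}) (x : 'rV[R]_d) : Prop :=
  exists c : 'I_n -> R, (forall i, 0 <= c i) /\
    x = \sum_(i in sigma) c i *: map_mx intr (row i b).

(* A piecewise linear function with integer values h_i at b_i which is
   strictly convex on the fan, i.e. the support function of an ample divisor
   -\sum_i h_i D_i. *)
Definition strictly_convex_support (h : 'I_n -> int) : Prop :=
  forall sigma, sigma \in Delta -> #|sigma| = d ->
    exists m : 'cV[int]_d,
      (forall i, i \in sigma -> (row i b *m m) 0 0 = h i) /\
      (forall i, i \notin sigma -> h i < (row i b *m m) 0 0).

Record smooth_projective_fan (R : realType) : Prop := SmoothProjectiveFan {
  fan_complex : forall sigma tau : {set 'I_n},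
    sigma \in Delta -> tau \subset sigma -> tau \in Delta;
  fan_zero : set0 \in Delta;
  fan_rays : forall i : 'I_n, [set i] \in Delta;
  fan_cap : forall (sigma tau : {set 'I_n}) (x : 'rV[R]_d),
    sigma \in Delta -> tau \in Delta ->
    in_cone sigma x -> in_cone tau x -> in_cone (sigma :&: tau) x;
  (* the generators of each cone are part of a basis of Z^d, namely the rows
     of the unimodular matrix P; in particular each b_i is primitive *)
  fan_smooth : forall sigma, sigma \in Delta ->
    exists (P : 'M[int]_d) (g : 'I_n -> 'I_d),
      [/\ P \in unitmx, {in sigma &, injective g} &
          {in sigma, forall i, row i b = row (g i) P}];
  fan_complete : forall x : 'rV[R]_d,
    exists2 sigma, sigma \in Delta & in_cone sigma x;
  fan_projective : exists h, strictly_convex_support h }.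

Definition exact_seq (r : nat) (A : 'M[int]_(r, n)) : Prop :=
  [/\ forall v : 'cV[int]_d, b *m v = 0 -> v = 0,
      forall u : 'cV[int]_n, A *m u = 0 <-> exists v : 'cV[int]_d, u = b *m v &
      forall w : 'cV[int]_r, exists u : 'cV[int]_n, A *m u = w].

End ToricData.

Section Regularity.
Variables (k : fieldType) (n r : nat) (A : 'M[int]_(r, n)).
Variable Delta : {set {set 'I_n}}.
Local Notation S := {mpoly k[n]}.
Local Notation grp := 'cV[int]_r.

Definition mdegA (u : 'X_{1..n}) : grp := A *m \col_i (u i)%:Z.

Definition homogA (p : grp) (f : S) : Prop :=
  forall u, u \in msupp f -> mdegA u = p.

Definition irr_gen (sigma : {set 'I_n}) : S := \prod_(i in ~: sigma) 'X_i.

Definition irrelevant_ideal : ideal S :=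
  ideal_gen (fun f => exists2 sigma, sigma \in Delta & f = irr_gen sigma).

Definition semigroupA (sigma : {set 'I_n}) (p : grp) : Prop :=
  exists l : 'I_n -> nat, p = \sum_(i in sigma) col i A *+ l i.

Definition nefK (p : grp) : Prop :=
  forall sigma, sigma \in Delta -> semigroupA (~: sigma) p.

Definition hilbert_basis (e : nat) (c : 'I_e -> grp) : Prop :=
  let generates (J : {set 'I_e}) := forall p : grp, nefK p <->
    exists l : 'I_e -> nat, p = \sum_(j in J) c j *+ l j in
  generates setT /\ (forall J, generates J -> J = setT).

(* Local cohomology with support in the irrelevant ideal, as the cohomology of
   the Cech complex on the generators [irr_gen sigma], sigma in Delta:
     C^i = \prod_(T \subset Delta, #|T| = i) M_(cech_den T).
   As S is Noetherian, these are also the derived functors of B-torsion.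
   The module M comes with its homogeneous components [gr p]. *)
Section LocalCohomology.
Variables (M : lmodType S) (gr : grp -> M -> Prop).

Definition cech_den (T : {set {set 'I_n}}) : S :=
  \prod_(sigma in T) irr_gen sigma.

Definition cech_deg (T : {set {set 'I_n}}) : grp :=
  \sum_(sigma in T) \sum_(i in ~: sigma) col i A.

(* Only the components indexed by T \subset Delta with #|T| = i matter when a
   cochain is considered in degree i. *)
Definition cochain := forall T : {set {set 'I_n}}, loc M (cech_den T).

Definition loc_gr (T : {set {set 'I_n}}) (p : grp) (x : loc M (cech_den T)) :=
  exists (m : M) (t : nat), gr (p + cech_deg T *+ t) m /\ x = frac m t.

Definition cech_pos (sigma : {set 'I_n}) (T : {set {set 'I_n}}) : nat :=
  #|[set tau in T | (enum_rank tau < enum_rank sigma)%N]|.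

Definition cech_diff (c : cochain) : cochain := fun T =>
  \sum_(sigma in T)
    loc_map (cech_den T) (irr_gen sigma) (c (T :\ sigma))
      *~ (-1) ^+ cech_pos sigma T.

Definition cech_cocycle (i : nat) (p : grp) (c : cochain) : Prop :=
  (forall T : {set {set 'I_n}}, T \subset Delta ->
     #|T| = i -> loc_gr p (c T)) /\
  (forall T : {set {set 'I_n}}, T \subset Delta ->
     #|T| = i.+1 -> cech_diff c T = 0).

Definition cech_coboundary (i : nat) (p : grp) (c : cochain) : Prop :=
  exists c' : cochain,
    (forall T : {set {set 'I_n}}, T \subset Delta ->
       #|T|.+1 = i -> loc_gr p (c' T)) /\
    (forall T : {set {set 'I_n}}, T \subset Delta ->
       #|T| = i -> c T = cech_diff c' T).

(* H^i_B(M)_p = 0 *)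
Definition loc_coh_zero (i : nat) (p : grp) : Prop :=
  forall c, cech_cocycle i p c -> cech_coboundary i p c.

Definition regular (e : nat) (c : 'I_e -> grp) (q : grp) : Prop :=
  (forall i, (0 < i)%N -> forall l : 'I_e -> nat, (\sum_j l j)%N = i.-1 ->
     forall p, nefK p -> loc_coh_zero i (q - \sum_j c j *+ l j + p)) /\
  (forall (j : 'I_e) p, nefK p -> loc_coh_zero 0 (q + c j + p)).

End LocalCohomology.

Definition quot_gr (I : ideal S) (p : grp) (x : quot_mod I) : Prop :=
  exists f : S, homogA p f /\ x = to_quot I f.

Definition reg_quot (e : nat) (c : 'I_e -> grp) (I : ideal S) : grp -> Prop :=
  regular (@quot_gr I) c.

Definition face_ideal (sigma : {set 'I_n}) : ideal S :=
  ideal_gen (fun f => exists2 i, i \notin sigma & f = 'X_i).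

Definition reg_face (e : nat) (c : 'I_e -> grp) (sigma : {set 'I_n}) :
    grp -> Prop :=
  reg_quot c (face_ideal sigma).

End Regularity.

Definition translate (V : zmodType) (v : V) (P : V -> Prop) (w : V) : Prop :=
  exists2 q, P q & w = v + q.

Section Stanley.
Variables (k : fieldType) (n : nat).
Local Notation S := {mpoly k[n]}.
Local Notation spair := ('X_{1..n} * {set 'I_n})%type.

Definition monomial_ideal (I : ideal S) : Prop :=
  exists G : 'X_{1..n} -> Prop, forall f,
    I f <-> ideal_gen (fun g => exists2 u, G u & g = 'X_[u]) f.

Definition in_spair (x : spair) (w : 'X_{1..n}) : Prop :=
  exists v : 'X_{1..n},
    (forall i, v i <> 0%N -> i \in x.2) /\ w = (x.1 + v)%MM.

Definition stanley_decomposition (I : ideal S) (s : seq spair) : Prop :=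
  [/\ uniq s,
      forall w, ~ I 'X_[w] <-> exists2 x, x \in s & in_spair x w &
      forall x y w, x \in s -> y \in s -> in_spair x w -> in_spair y w -> x = y].

Definition stanley_filtration (I : ideal S) (s : seq spair) : Prop :=
  stanley_decomposition I s /\
  forall j, (1 <= j <= size s)%N ->
    stanley_decomposition
      (ideal_add I (fun f => exists2 x, x \in drop j s & f = 'X_[x.1]))
      (take j s).

End Stanley.

(* Main.v *)
(* Put K_j = I + <x^{u_{j+1}}, ..., x^{u_m}>, so that K_0 = S and K_m = I. The
   filtration condition says precisely that (K_{j+1} : x^{u_{j+1}}) is the face
   ideal of sigma_{j+1}, which gives graded exact sequences
     0 -> S_{sigma_{j+1}}(- A u_{j+1}) -> S/K_{j+1} -> S/K_j -> 0,
   and local cohomology is half exact: this yields the first inclusion one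
   degree at a time. If the complement of sigma is not in Delta, then S_sigma is
   B-torsion and has no cohomology in positive degrees, so such pairs only
   matter for H^0; and H^0_B(S/I) = 0 when I is B-saturated. *)
Require Import Defs.
From HB Require Import structures.
From mathcomp Require Import all_boot all_order all_algebra.
From mathcomp Require Import boolp reals.
From mathcomp Require Import mpoly ring.
Import GRing.Theory.
Local Open Scope ring_scope.

Set Implicit Arguments.
Unset Strict Implicit.
Unset Printing Implicit Defensive.

Local Notation frac := Defs.frac.

(** Split the inner sum by rank into [t] before [s] and [t] after [s]; exchanging the order of
    summation in the second half matches each [F s t] with [F t s]. This is the cancellation behind
    the vanishing of the squared Cech differential. *)
Lemma sum_antisymmetric (V : zmodType) (J : finType) (T : {set J})
    (F : J -> J -> V) :
  (forall s t, s \in T -> t \in T -> (enum_rank t < enum_rank s)%N ->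
     F s t = - F t s) ->
  \sum_(s in T) \sum_(t in T | t != s) F s t = 0.
Proof.
move=> antisym; rewrite (eq_bigr (fun s =>
    \sum_(t in T | (enum_rank t < enum_rank s)%N) F s t +
    \sum_(t in T | (enum_rank s < enum_rank t)%N) F s t)).
  rewrite big_split /= [X in _ + X](exchange_big_dep (mem T)) /=; last first.
    by move=> ? ? _ /andP[].
  rewrite -big_split big1 //= => s sT.
  rewrite [X in _ + X](eq_bigl (fun t => (t \in T) &&
     (enum_rank t < enum_rank s)%N)); last by move=> t; rewrite sT.
  rewrite -big_split big1 //= => t /andP[tT lt].
  by rewrite antisym // addNr.
move=> s sT; rewrite (bigID (fun t => (enum_rank t < enum_rank s)%N)) /=.
congr (_ + _); apply: eq_bigl => t; rewrite -andbA; congr (_ && _).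
  by apply: andb_idl => lt; apply: contraTneq lt => ->; rewrite ltnn.
by rewrite -leqNgt ltn_neqAle (inj_eq val_inj) (inj_eq enum_rank_inj) eq_sym.
Qed.

(** * Localizations of modules and of linear maps *)

Section LocalizationTheory.
Variable S : comNzRingType.

Section OneModule.
Variable M : lmodType S.

Lemma frac_eq0 (f : S) (m : M) t :
  (frac m t : loc M f) = 0 <-> exists j, f ^+ j *: m = 0.
Proof.
split=> [/frac_eq[j]|[j e]].
  by rewrite scaler0 subr0 expr0 scale1r; exists j.
by apply/frac_eq; exists j; rewrite scaler0 subr0 expr0 scale1r.
Qed.

Lemma fracD (f : S) (m m' : M) s s' :
  frac m s + frac m' s' =
    frac (f ^+ s' *: m + f ^+ s *: m') (s + s') :> loc M f.
Proof. exact: loc_addE. Qed.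

Lemma fracN (f : S) (m : M) s : - frac m s = frac (- m) s :> loc M f.
Proof. exact: loc_oppE. Qed.

Lemma fracX (f : S) (m : M) s j :
  frac (f ^+ j *: m) (j + s) = frac m s :> loc M f.
Proof.
by apply/frac_eq; exists 0%N; rewrite scalerA -exprD addnC subrr scaler0.
Qed.

(** [loc_map] respects fractions only when [h = g * f], so additivity carries this equation as a
    premise instead of being registered as a structure on the map. *)
Lemma loc_map_is_additive (f h g : S) : h = g * f ->
  {morph (@loc_map _ M f h g) : x y / x + y}.
Proof.
move=> e x y; rewrite -(fracK x) -(fracK y) fracD !(loc_mapE _ _ e) fracD.
rewrite e scalerDr !scalerA !exprMn !exprD.
have swap (v w z : S) : v * w * z = z * w * v by ring.
by congr (frac (_ *: _ + _ *: _) _); [rewrite swap mulrC mulrA|rewrite mulrAC].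
Qed.

Lemma loc_map0 (f h g : S) : h = g * f -> loc_map h g (0 : loc M f) = 0.
Proof.
move=> e; apply: (addrI (loc_map h g (0 : loc M f))).
by rewrite -(loc_map_is_additive e) !addr0.
Qed.

Lemma loc_mapN (f h g : S) : h = g * f ->
  {morph (@loc_map _ M f h g) : x / - x}.
Proof.
move=> e x; apply: (addrI (loc_map h g x)).
by rewrite -(loc_map_is_additive e) !subrr loc_map0.
Qed.

Lemma loc_mapB (f h g : S) : h = g * f ->
  {morph (@loc_map _ M f h g) : x y / x - y}.
Proof.
by move=> e x y; rewrite (loc_map_is_additive e) (loc_mapN e).
Qed.

Lemma loc_map_signz (f h g : S) (x : loc M f) j : h = g * f ->
  loc_map h g (x *~ (-1) ^+ j) = loc_map h g x *~ (-1) ^+ j.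
Proof.
move=> e; rewrite -signr_odd; case: (odd j); rewrite ?expr1 ?expr0 ?mulr1z //.
by rewrite !mulrN1z (loc_mapN e).
Qed.

Lemma loc_map_sum (f h g : S) (J : Type) (s : seq J) (P : pred J)
    (F : J -> loc M f) : h = g * f ->
  loc_map h g (\sum_(j <- s | P j) F j) =
  \sum_(j <- s | P j) loc_map h g (F j).
Proof.
move=> e.
exact: (big_morph _ (loc_map_is_additive e) (loc_map0 e)).
Qed.

Lemma loc_map_comp (f f' h g g' : S) (x : loc M f) :
  f' = g * f -> h = g' * f' ->
  loc_map h g' (loc_map f' g x) = loc_map h (g' * g) x.
Proof.
move=> e e'; rewrite -(fracK x) (loc_mapE _ _ e) (loc_mapE _ _ e').
by rewrite loc_mapE ?e' ?e ?mulrA // exprMn scalerA.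
Qed.

End OneModule.

(** Computed on a chosen representative; for linear [phi] the choice is immaterial, by
    [loc_funE]. *)
Definition loc_fun (M N : lmodType S) (f : S) (phi : M -> N) (x : loc M f) :
  loc N f := frac (phi (repr x).1) (repr x).2.

Section TwoModules.
Variables (M N : lmodType S) (phi : {linear M -> N}).

Lemma loc_funE (f : S) m t : loc_fun phi (frac m t : loc M f) = frac (phi m) t.
Proof.
have /frac_eq[j] := fracK (frac m t : loc M f).
rewrite /loc_fun; move: (repr _) => [m' s] /= e; apply/frac_eq; exists j.
by rewrite -!linearZ -linearB -linearZ e linear0.
Qed.

Lemma loc_fun_is_additive (f : S) :
  zmod_morphism (fun x : loc M f => loc_fun phi x).
Proof.
move=> x y; rewrite -(fracK x) -(fracK y) fracN fracD !loc_funE fracN fracD.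
by rewrite linearD !linearZ linearN.
Qed.

HB.instance Definition _ (f : S) :=
  GRing.isZmodMorphism.Build (loc M f) (loc N f) (@loc_fun M N f phi)
    (@loc_fun_is_additive f).

Lemma loc_fun_map (f h g : S) (x : loc M f) : h = g * f ->
  loc_fun phi (loc_map h g x) = loc_map h g (loc_fun phi x).
Proof.
move=> e; rewrite -(fracK x) (loc_mapE _ _ e) !loc_funE (loc_mapE _ _ e).
by rewrite linearZ.
Qed.

(** The power of [f] that kills the image of a numerator already kills the numerator. *)
Lemma loc_fun_inj (f : S) : injective phi ->
  injective (fun x : loc M f => loc_fun phi x).
Proof.
move=> inj x y; rewrite -(fracK x) -(fracK y) !loc_funE => /frac_eq[j].
rewrite -!linearZ -linearB -linearZ => e; apply/frac_eq; exists j.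
by apply: inj; rewrite e linear0.
Qed.

End TwoModules.

End LocalizationTheory.

(** * The graded Cech complex *)

Section CechTheory.
Variables (k : fieldType) (n r : nat) (A : 'M[int]_(r, n)).
Variable Delta : {set {set 'I_n}}.
Local Notation S := {mpoly k[n]}.
Local Notation grp := 'cV[int]_r.
Implicit Types (T : {set {set 'I_n}}) (p : grp).

Lemma cech_denD1 T sigma : sigma \in T ->
  cech_den k T = irr_gen k sigma * cech_den k (T :\ sigma).
Proof. by move=> sT; rewrite /cech_den (big_setD1 sigma). Qed.

Lemma cech_degD1 T sigma : sigma \in T ->
  cech_deg A T = \sum_(i in ~: sigma) col i A + cech_deg A (T :\ sigma).
Proof. by move=> sT; rewrite /cech_deg (big_setD1 sigma). Qed.

Section Complex.
Variable M : lmodType S.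

(** Cochains are total functions with uncontrolled values outside the relevant index sets, so they
    are compared only where the differential at [T] reads them. *)
Lemma cech_diff_eq (c c' : cochain M) T :
  (forall sigma, sigma \in T -> c (T :\ sigma) = c' (T :\ sigma)) ->
  cech_diff c T = cech_diff c' T.
Proof. by move=> e; apply: eq_bigr => sigma /e ->. Qed.

Lemma cech_diff0 T : cech_diff (fun U => 0 : loc M (cech_den k U)) T = 0.
Proof.
apply: big1 => sigma sT; rewrite loc_map0 ?mul0rz //.
exact: cech_denD1.
Qed.

Lemma cech_diffB (c c' : cochain M) T :
  cech_diff (fun U => c U - c' U) T = cech_diff c T - cech_diff c' T.
Proof.
rewrite /cech_diff -[RHS]sumrB; apply: eq_bigr => sigma sT.
by rewrite -[RHS]mulrzBl; congr (_ *~ _); apply: loc_mapB (cech_denD1 sT) _ _.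
Qed.

Lemma cech_diffD (c c' : cochain M) T :
  cech_diff (fun U => c U + c' U) T = cech_diff c T + cech_diff c' T.
Proof.
rewrite /cech_diff -[RHS]big_split; apply: eq_bigr => sigma sT /=.
rewrite -[RHS]mulrzDl; congr (_ *~ _).
exact: loc_map_is_additive (cech_denD1 sT) _ _.
Qed.

(** This shift by one, absent from [cech_posD1_ge], is why removing two elements in the two possible
    orders yields opposite signs. *)
Lemma cech_posD1 (sigma tau : {set 'I_n}) T : tau \in T ->
  (enum_rank tau < enum_rank sigma)%N ->
  cech_pos sigma T = (cech_pos sigma (T :\ tau)).+1.
Proof.
move=> tT lt; rewrite /cech_pos (cardsD1 tau) inE tT lt add1n; congr _.+1.
by congr #|pred_of_set _|; apply/setP=> u; rewrite !inE andbA.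
Qed.

Lemma cech_posD1_ge (sigma tau : {set 'I_n}) T :
  (enum_rank sigma <= enum_rank tau)%N ->
  cech_pos sigma (T :\ tau) = cech_pos sigma T.
Proof.
move=> le; rewrite /cech_pos.
congr #|pred_of_set _|; apply/setP=> u; rewrite !inE.
case: eqP => [->|] //=; by rewrite ltnNge le andbF.
Qed.

(** The square is a double sum over ordered pairs removed from [T]; swapping a pair keeps the
    localization map and flips the sign. *)
Lemma cech_diffK (c : cochain M) T : cech_diff (cech_diff c) T = 0.
Proof.
(* [G U] goes from index [U] to [T] in one localization map, multiplying by all missing generators,
   so it does not see the order of removal. *)
pose G U := loc_map (cech_den k T)
  (\prod_(sigma in T :\: U) irr_gen k sigma) (c U) : loc M (cech_den k T).
pose F sigma tau :=
  G (T :\ sigma :\ tau) *~ ((-1) ^+ cech_pos tau (T :\ sigma))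
                        *~ ((-1) ^+ cech_pos sigma T).
have -> : cech_diff (cech_diff c) T =
    \sum_(sigma in T) \sum_(tau in T | tau != sigma) F sigma tau.
  rewrite {1}/cech_diff; apply: eq_bigr => sigma sT.
  have e := cech_denD1 sT.
  transitivity ((\sum_(tau in T :\ sigma)
      G (T :\ sigma :\ tau) *~ ((-1) ^+ cech_pos tau (T :\ sigma)))
    *~ ((-1) ^+ cech_pos sigma T)).
    congr (_ *~ _); apply: etrans (loc_map_sum _ _ _ e) _.
    apply: eq_bigr => tau tT'.
    apply: etrans (loc_map_signz _ _ e) _; congr (_ *~ _).
    apply: etrans (loc_map_comp _ (cech_denD1 tT') e) _.
    move: tT'; rewrite !inE => /andP[ts tT].
    rewrite /G; congr (loc_map _ _ _).
    have -> : T :\: (T :\ sigma :\ tau) = sigma |: [set tau].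
      apply/setP=> u; rewrite !inE.
      have [->|_] := eqVneq u tau; first by rewrite tT orbT.
      have [->|_] := eqVneq u sigma; first by rewrite sT.
      by case: (u \in T).
    by rewrite big_setU1 ?big_set1 //= inE eq_sym.
  apply: etrans (mulrz_suml _ _ _ _) _.
  by apply: eq_bigl => tau; rewrite !inE andbC.
have antisym sigma tau : sigma \in T -> tau \in T ->
    (enum_rank tau < enum_rank sigma)%N -> F sigma tau = - F tau sigma.
  move=> sT tT lt; rewrite /F.
  have -> : T :\ sigma :\ tau = T :\ tau :\ sigma.
    by apply/setP => u; rewrite !inE andbCA.
  rewrite (cech_posD1 tT lt) (cech_posD1_ge _ (ltnW lt)) -!mulrzA exprS.
  by rewrite mulN1r mulrN mulrNz mulrC.
exact: sum_antisymmetric antisym.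
Qed.

End Complex.

(** The part of a grading that the Cech complex sees: components that are subgroups and shift
    correctly under the generators of the irrelevant ideal. *)
Record graded_module (M : lmodType S) (gr : grp -> M -> Prop) : Prop :=
  GradedModule {
    gr0 : forall p, gr p 0;
    grB : forall p x y, gr p x -> gr p y -> gr p (x - y);
    gr_irr : forall p (sigma : {set 'I_n}) x,
      gr p x -> gr (p + \sum_(i in ~: sigma) col i A) (irr_gen k sigma *: x) }.

Section Graded.
Variables (M : lmodType S) (gr : grp -> M -> Prop).
Hypothesis hgr : graded_module gr.

Lemma grN p x : gr p x -> gr p (- x).
Proof. by rewrite -sub0r; apply: grB => //; apply: gr0. Qed.

Lemma grD p x y : gr p x -> gr p y -> gr p (x + y).
Proof. by move=> gx gy; rewrite -[y]opprK; apply: grB => //; apply: grN. Qed.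

Lemma gr_irrX p (sigma : {set 'I_n}) t x : gr p x ->
  gr (p + (\sum_(i in ~: sigma) col i A) *+ t) (irr_gen k sigma ^+ t *: x).
Proof.
move=> gx; elim: t => [|t IH]; first by rewrite addr0 scale1r.
by rewrite mulrSr addrA exprS -scalerA; apply: gr_irr.
Qed.

Lemma gr_den p T x : gr p x -> gr (p + cech_deg A T) (cech_den k T *: x).
Proof.
rewrite /cech_deg /cech_den => gx.
elim/big_rec2: _ => [|sigma f v _ IH]; first by rewrite addr0 scale1r.
by rewrite addrC -addrA addrC [_ + p]addrC -scalerA; apply: gr_irr.
Qed.

Lemma gr_denX p T t x :
  gr p x -> gr (p + cech_deg A T *+ t) (cech_den k T ^+ t *: x).
Proof.
move=> gx; elim: t => [|t IH]; first by rewrite addr0 scale1r.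
by rewrite mulrSr addrA exprS -scalerA; apply: gr_den.
Qed.

Lemma loc_gr0 T p : loc_gr A gr p (0 : loc M (cech_den k T)).
Proof. by exists 0, 0%N; split=> //; apply: gr0. Qed.

Lemma loc_grN T p (x : loc M (cech_den k T)) :
  loc_gr A gr p x -> loc_gr A gr p (- x).
Proof.
move=> [m [t [gm ->]]]; exists (- m), t; rewrite fracN.
by split=> //; apply: grN.
Qed.

Lemma loc_grD T p (x y : loc M (cech_den k T)) :
  loc_gr A gr p x -> loc_gr A gr p y -> loc_gr A gr p (x + y).
Proof.
move=> [m [s [gm ->]]] [m' [s' [gm' ->]]]; rewrite fracD.
exists (cech_den k T ^+ s' *: m + cech_den k T ^+ s *: m'), (s + s')%N.
split=> //; rewrite mulrnDr; apply: grD.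
  by rewrite addrA; apply: gr_denX.
by rewrite addrCA addrC; apply: gr_denX.
Qed.

Lemma loc_gr_map T p sigma (x : loc M (cech_den k (T :\ sigma))) :
  sigma \in T -> loc_gr A gr p x ->
  loc_gr A gr p (loc_map (cech_den k T) (irr_gen k sigma) x).
Proof.
move=> sT [m [t [gm ->]]]; rewrite (loc_mapE _ _ (cech_denD1 sT)).
exists (irr_gen k sigma ^+ t *: m), t; split=> //.
by rewrite (cech_degD1 sT) mulrnDl addrCA addrC; apply: gr_irrX.
Qed.

Lemma loc_gr_diff T p (c : cochain M) :
  (forall sigma, sigma \in T -> loc_gr A gr p (c (T :\ sigma))) ->
  loc_gr A gr p (cech_diff c T).
Proof.
move=> gc; rewrite /cech_diff; apply: big_ind => [||sigma sT].
- exact: loc_gr0.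
- exact: loc_grD.
rewrite -signr_odd; case: (odd _); rewrite ?expr1 ?expr0 ?mulr1z ?mulrN1z.
  by apply/loc_grN/loc_gr_map => //; apply: gc.
by apply: loc_gr_map => //; apply: gc.
Qed.

Lemma loc_coh_zero_trivial i p :
  (forall T, T \subset Delta -> #|T| = i ->
     forall x : loc M (cech_den k T), x = 0) ->
  loc_coh_zero A Delta gr i p.
Proof.
move=> z c _; exists (fun T => 0); split=> T sT cT; first exact: loc_gr0.
by rewrite cech_diff0; apply: z.
Qed.

End Graded.

Lemma cech_diff_fun (M N : lmodType S) (phi : {linear M -> N})
    (c : cochain M) T :
  cech_diff (fun U => loc_fun phi (c U)) T = loc_fun phi (cech_diff c T).
Proof.
rewrite /cech_diff [RHS]raddf_sum; apply: eq_bigr => sigma sT.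
rewrite [RHS]raddfMz; congr (_ *~ _).
exact/esym/loc_fun_map/cech_denD1.
Qed.

(** * Half exactness for a graded sequence 0 -> M'(-a) -> M -> M'' -> 0 *)

Section ShortExact.
Variables (M' M M'' : lmodType S).
Variables (gr' : grp -> M' -> Prop) (gr : grp -> M -> Prop).
Variable gr'' : grp -> M'' -> Prop.
Variables (phi : {linear M' -> M}) (psi : {linear M -> M''}) (a : grp).
Hypothesis hgr : graded_module gr.
Hypothesis phi_inj : injective phi.
Hypothesis gr_phi : forall p x, gr' p x -> gr (a + p) (phi x).
Hypothesis gr_psi : forall p x, gr p x -> gr'' p (psi x).
Hypothesis gr_ex : forall p x, gr p x -> psi x = 0 ->
  exists2 y, gr' (p - a) y & phi y = x.
Hypothesis gr_surj : forall p x, gr'' p x -> exists2 y, gr p y & psi y = x.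

Lemma loc_gr_phi T p (x : loc M' (cech_den k T)) :
  loc_gr A gr' (p - a) x -> loc_gr A gr p (loc_fun phi x).
Proof.
move=> [m [t [gm ->]]]; exists (phi m), t; rewrite loc_funE; split=> //.
by move/gr_phi: gm; rewrite addrA [p - a]addrC addNKr.
Qed.

Lemma loc_gr_psi T p (x : loc M (cech_den k T)) :
  loc_gr A gr p x -> loc_gr A gr'' p (loc_fun psi x).
Proof.
move=> [m [t [gm ->]]]; exists (psi m), t; rewrite loc_funE.
by split=> //; apply: gr_psi.
Qed.

Lemma loc_gr_surj T p (x : loc M'' (cech_den k T)) : loc_gr A gr'' p x ->
  exists2 y, loc_gr A gr p y & loc_fun psi y = x.
Proof.
move=> [m [t [/gr_surj[y gy <-] ->]]].
by exists (frac y t); rewrite ?loc_funE //; exists y, t.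
Qed.

(** A numerator whose image vanishes in the localization lies in the kernel of [psi] only after
    multiplication by a power of the denominator; [fracX] absorbs that power into the fraction. *)
Lemma loc_gr_ex T p (x : loc M (cech_den k T)) :
  loc_gr A gr p x -> loc_fun psi x = 0 ->
  exists2 y, loc_gr A gr' (p - a) y & loc_fun phi y = x.
Proof.
move=> [m [t [gm ->]]]; rewrite loc_funE => /frac_eq0[j].
rewrite -linearZ => /(gr_ex (gr_denX hgr T j gm))[y gy ey].
exists (frac y (j + t)); last by rewrite loc_funE ey fracX.
exists y, (j + t)%N; split=> //.
by rewrite [(j + t)%N]addnC mulrnDr addrA [p - a + _]addrAC addrAC.
Qed.

(** Diagram chase: write the image of [c] as d [b''], lift [b''] to [b], pull [c] - d [b] back to a
    cocycle [b'], and write [b'] as d [a']; then [c] is d of [b] plus the image of [a']. Degree 0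
    needs no separate case, since the differential at the empty index set is an empty sum. *)
Lemma loc_coh_zero_middle i p :
  loc_coh_zero A Delta gr' i (p - a) -> loc_coh_zero A Delta gr'' i p ->
  loc_coh_zero A Delta gr i p.
Proof.
move=> z' z'' c [gc dc].
have [b'' [gb'' db'']] : cech_coboundary A Delta gr'' i p
    (fun T => loc_fun psi (c T)).
  apply: z''; split=> T sT cT; first exact/loc_gr_psi/gc.
  by rewrite cech_diff_fun dc // raddf0.
(* Lifts are chosen independently at each index set, with 0 as filler where no condition is
   imposed. *)
have [b hb] : {b : cochain M | forall T, T \subset Delta -> #|T|.+1 = i ->
    loc_gr A gr p (b T) /\ loc_fun psi (b T) = b'' T}.
  apply: constructive_indefinite_description.
  have hb T : exists y : loc M (cech_den k T), T \subset Delta ->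
      #|T|.+1 = i -> loc_gr A gr p y /\ loc_fun psi y = b'' T.
    have [[sT cT]|nT] := pselect (T \subset Delta /\ #|T|.+1 = i).
      by have [y] := loc_gr_surj (gb'' T sT cT); exists y.
    by exists 0 => sT cT; case: nT.
  by exists (fun T => projT1 (cid (hb T))) => T; case: cid.
have subD1 T sigma : sigma \in T -> T \subset Delta -> #|T| = i ->
    T :\ sigma \subset Delta /\ #|T :\ sigma|.+1 = i.
  move=> sT sub <-; split; first exact: subset_trans (subsetDl _ _) sub.
  by rewrite (cardsD1 sigma T) sT.
pose c1 : cochain M := fun T => c T - cech_diff b T.
have gc1 T : T \subset Delta -> #|T| = i -> loc_gr A gr p (c1 T).
  move=> sT cT; apply: loc_grD (gc T sT cT) _ => //; apply: loc_grN => //.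
  apply: loc_gr_diff => // sigma sgT; have [? ?] := subD1 T sigma sgT sT cT.
  by case: (hb (T :\ sigma)).
have zc1 T : T \subset Delta -> #|T| = i -> loc_fun psi (c1 T) = 0.
  move=> sT cT; rewrite raddfB /= -cech_diff_fun db'' //; apply/eqP.
  rewrite subr_eq0; apply/eqP/cech_diff_eq => sigma sgT.
  by have [? ?] := subD1 T sigma sgT sT cT; case: (hb (T :\ sigma)).
have [b' hb'] : {b' : cochain M' | forall T, T \subset Delta -> #|T| = i ->
    loc_gr A gr' (p - a) (b' T) /\ loc_fun phi (b' T) = c1 T}.
  apply: constructive_indefinite_description.
  have hb' T : exists y : loc M' (cech_den k T), T \subset Delta ->
      #|T| = i -> loc_gr A gr' (p - a) y /\ loc_fun phi y = c1 T.
    have [[sT cT]|nT] := pselect (T \subset Delta /\ #|T| = i).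
      by have [y] := loc_gr_ex (gc1 T sT cT) (zc1 T sT cT); exists y.
    by exists 0 => sT cT; case: nT.
  by exists (fun T => projT1 (cid (hb' T))) => T; case: cid.
(* [b'] is a cocycle because its image [c1] is one and the localized [phi] is injective. *)
have [a' [ga' da']] : cech_coboundary A Delta gr' i (p - a) b'.
  apply: z'; split=> T sT cT; first by case: (hb' T).
  apply: (loc_fun_inj phi_inj); rewrite raddf0 -cech_diff_fun.
  transitivity (cech_diff c1 T).
    apply: cech_diff_eq => sigma sgT.
    have sub : T :\ sigma \subset Delta.
      exact: subset_trans (subsetDl _ _) sT.
    by case: (hb' _ sub) => //; move: cT; rewrite (cardsD1 sigma) sgT => -[].
  by rewrite cech_diffB dc // cech_diffK subrr.
exists (fun T => b T + loc_fun phi (a' T)); split=> T sT cT.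
  apply: loc_grD => //; first by case: (hb T).
  exact/loc_gr_phi/ga'.
rewrite cech_diffD cech_diff_fun -da' //; case: (hb' T) => // _ ->.
by rewrite /c1 addrC subrK.
Qed.

End ShortExact.
End CechTheory.

(** * Monomial ideals through the supports of their elements *)

Section MonomialIdeals.
Variables (k : fieldType) (n : nat).
Local Notation S := {mpoly k[n]}.
Implicit Types (I J : ideal S) (u v w : 'X_{1..n}).

Lemma ideal_gen_mem (G : S -> Prop) g : G g -> ideal_gen G g.
Proof.
move=> Gg; exists [:: (1, g)]; split; first by move=> x; rewrite inE => /eqP->.
by rewrite big_seq1 mul1r.
Qed.

Lemma ideal_mem_sum I (J : eqType) (s : seq J) (P : pred J) (F : J -> S) :
  (forall j, j \in s -> P j -> I (F j)) -> I (\sum_(j <- s | P j) F j).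
Proof.
move=> IF; rewrite big_seq_cond; apply: big_ind.
- exact: ideal_mem0.
- exact: ideal_memD.
by move=> j /andP[js Pj]; apply: IF.
Qed.

Lemma ideal_gen_sub (G : S -> Prop) I :
  (forall g, G g -> I g) -> forall f, ideal_gen G f -> I f.
Proof.
move=> GI f [s [Gs ->]]; apply: ideal_mem_sum => x xs _.
by apply/ideal_memM/GI/Gs.
Qed.

Fact colon0 I h : I (h * 0).
Proof. by rewrite mulr0; apply: ideal_mem0. Qed.

Fact colonD I h f g : I (h * f) -> I (h * g) -> I (h * (f + g)).
Proof. by rewrite mulrDr; apply: ideal_memD. Qed.

Fact colonM I h f g : I (h * g) -> I (h * (f * g)).
Proof. by rewrite mulrCA; apply: ideal_memM. Qed.

(** Having the colon as an ideal lets [ideal_gen_sub] check inclusions into it on generators. *)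
Definition ideal_colon I h : ideal S :=
  Ideal (@colon0 I h) (@colonD I h) (@colonM I h).

(** Equality of records is wanted because the ideal is a parameter of the quotient type, along which
    vanishing of cohomology is transported. *)
Lemma ideal_ext I J : (forall f, I f <-> J f) -> I = J.
Proof.
case: I J => [P P0 PD PM] [Q Q0 QD QM] /= e.
have eP : P = Q by apply: funext => f; apply: propext.
subst Q; congr Ideal; exact: Prop_irrelevance.
Qed.

(** The property of monomial ideals used below; it passes to the intermediate ideals of a
    filtration. *)
Definition supp_closed I : Prop :=
  forall f w, I f -> w \in msupp f -> I 'X_[w].

Lemma ideal_mem_supp I f : (forall w, w \in msupp f -> I 'X_[w]) -> I f.
Proof.
move=> If; rewrite (mpolyE f); apply: ideal_mem_sum => w wf _.
by rewrite -mul_mpolyC; apply/ideal_memM/If.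
Qed.

(** Each monomial of a linear combination of generators is a multiple of a monomial of one of these
    generators. *)
Lemma ideal_gen_supp_closed (G : S -> Prop) :
  (forall g w, G g -> w \in msupp g -> ideal_gen G 'X_[w]) ->
  supp_closed (ideal_gen G).
Proof.
move=> hG f w [s [Gs ->]] /msupp_sum_le /flattenP[m /mapP[x]].
rewrite filter_predT => xs -> /msuppM_le /allpairsP[[w1 w2] /= [_ w2x ->]].
by rewrite mpolyXD; apply: lincombM; apply: hG w2x; apply: Gs.
Qed.

Lemma monomial_ideal_supp_closed I : monomial_ideal I -> supp_closed I.
Proof.
move=> [G IG] f w /IG If wf; apply/IG; move: If wf.
apply: ideal_gen_supp_closed => g w' [u Gu ->] /mem_msuppXP <-.
by apply: ideal_gen_mem; exists u.
Qed.

Lemma ideal_add_supp_closed I (s : seq ('X_{1..n} * {set 'I_n})) :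
  supp_closed I ->
  supp_closed (ideal_add I (fun f => exists2 x, x \in s & f = 'X_[x.1])).
Proof.
move=> cI; apply: ideal_gen_supp_closed => g w [Ig wg|[x xs ->]].
  by apply: ideal_gen_mem; left; apply: cI wg.
by move=> /mem_msuppXP <-; apply: ideal_gen_mem; right; exists x.
Qed.

Lemma face_ideal_mem (sigma : {set 'I_n}) w i :
  i \notin sigma -> w i <> 0%N -> face_ideal k sigma 'X_[w].
Proof.
move=> iN wi; have le : (U_(i) <= w)%MM by rewrite lep1mP; apply/eqP.
rewrite -(submK le) mpolyXD; apply/ideal_memM/ideal_gen_mem.
by exists i.
Qed.

End MonomialIdeals.

(** * Maps between cyclic quotients of the polynomial ring *)

Section QuotientModules.
Variables (k : fieldType) (n : nat).
Local Notation S := {mpoly k[n]}.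
Implicit Types I J : ideal S.

Lemma to_quot0 I : to_quot I 0 = 0.
Proof. by apply: (addrI (to_quot I 0)); rewrite -to_quotD !addr0. Qed.

Lemma to_quot_eq0 I f : to_quot I f = 0 <-> I f.
Proof. by rewrite -to_quot0 to_quotE subr0. Qed.

Lemma to_quotN I f : to_quot I (- f) = - to_quot I f.
Proof. by apply: (addrI (to_quot I f)); rewrite -to_quotD !subrr to_quot0. Qed.

Lemma to_quotB I f g : to_quot I (f - g) = to_quot I f - to_quot I g.
Proof. by rewrite to_quotD to_quotN. Qed.

Lemma to_quotZ I (f g : S) : f *: to_quot I g = to_quot I (f * g).
Proof. exact: quot_scaleE. Qed.

(** Well defined when h I is contained in J. It supplies both maps of the exact sequence: [h] is a
    monomial for the inclusion and 1 for the projection. *)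
Definition quot_mul I J (h : S) (x : quot_mod I) : quot_mod J :=
  to_quot J (h * generic_quotient.repr x).

Lemma quot_mulE I J h f : (forall g, I g -> J (h * g)) ->
  quot_mul J h (to_quot I f) = to_quot J (h * f).
Proof.
move=> IJ; apply/to_quotE; rewrite -mulrBr; apply: IJ.
by apply/to_quotE; rewrite to_quotK.
Qed.

Lemma quot_mul_linear I J h : (forall g, I g -> J (h * g)) ->
  linear (@quot_mul I J h).
Proof.
move=> IJ a x y; rewrite -[x]to_quotK -[y]to_quotK to_quotZ -to_quotD.
by rewrite !quot_mulE // to_quotZ -to_quotD mulrDr mulrCA.
Qed.

End QuotientModules.

(** * The grading by [A] on polynomials and quotients *)

Section Gradings.
Variables (k : fieldType) (n r : nat) (A : 'M[int]_(r, n)).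
Local Notation S := {mpoly k[n]}.
Implicit Types (p q : 'cV[int]_r) (f g : S).

Lemma mdegAD (u v : 'X_{1..n}) : mdegA A (u + v)%MM = mdegA A u + mdegA A v.
Proof.
rewrite /mdegA -mulmxDr; congr (_ *m _).
by apply/matrixP=> i j; rewrite !mxE mnmDE PoszD.
Qed.

Lemma mdegA1 i : mdegA A U_(i)%MM = col i A.
Proof.
apply/matrixP=> j l; rewrite !mxE (bigD1 i) //= big1 => [|i' ne].
  by rewrite !mxE mnm1E eqxx mulr1 addr0.
by rewrite !mxE mnm1E eq_sym (negPf ne) mulr0.
Qed.

Lemma homogA0 p : homogA A p (0 : S).
Proof. by move=> u; rewrite msupp0. Qed.

Lemma homogAB p f g : homogA A p f -> homogA A p g -> homogA A p (f - g).
Proof. by move=> hf hg u /msuppB_le; rewrite mem_cat => /orP[/hf|/hg]. Qed.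

Lemma homogAD p f g : homogA A p f -> homogA A p g -> homogA A p (f + g).
Proof. by move=> hf hg u /msuppD_le; rewrite mem_cat => /orP[/hf|/hg]. Qed.

Lemma homogAM p q f g :
  homogA A p f -> homogA A q g -> homogA A (p + q) (f * g).
Proof.
move=> hf hg u /msuppM_le /allpairsP[[v w] /= [/hf <- /hg <- ->]].
exact: mdegAD.
Qed.

Lemma homogAX (u : 'X_{1..n}) : homogA A (mdegA A u) ('X_[u] : S).
Proof. by move=> v /mem_msuppXP <-. Qed.

Lemma homogAZX p (a : k) (u : 'X_{1..n}) :
  mdegA A u = p -> homogA A p (a *: 'X_[u] : S).
Proof. by move=> <- v /msuppZ_le; apply: homogAX. Qed.

Lemma homogA_irr (sigma : {set 'I_n}) :
  homogA A (\sum_(i in ~: sigma) col i A) (irr_gen k sigma).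
Proof.
rewrite /irr_gen; elim/big_rec2: _ => [u|i f p _ IH].
  rewrite msupp1 inE => /eqP->; apply/matrixP => i j.
  rewrite !mxE big1 // => l _.
  by rewrite !mxE mnm0E mulr0.
by apply: homogAM => //; rewrite -mdegA1; apply: homogAX.
Qed.

Lemma quot_gr_graded (I : ideal S) : graded_module A (@quot_gr _ _ _ A I).
Proof.
split=> [p|p x y [f [hf ->]] [g [hg ->]]|p sigma x [f [hf ->]]].
- by exists 0; rewrite to_quot0; split=> //; apply: homogA0.
- by exists (f - g); rewrite to_quotB; split=> //; apply: homogAB.
exists (irr_gen k sigma * f); rewrite to_quotZ; split=> //.
by rewrite addrC; apply: homogAM => //; apply: homogA_irr.
Qed.

End Gradings.

(** * Vanishing along a Stanley filtration, for torsion faces, and for saturated ideals *)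

Section Filtration.
Variables (k : fieldType) (n r : nat) (A : 'M[int]_(r, n)).
Variable Delta : {set {set 'I_n}}.
Local Notation S := {mpoly k[n]}.
Local Notation coh0 I := (loc_coh_zero A Delta (@quot_gr k n r A I)).
Implicit Types (I J : ideal S) (x : 'X_{1..n} * {set 'I_n}).

Lemma in_spair_self x : in_spair x x.1.
Proof. by exists 0%MM; rewrite addm0; split=> // i; rewrite mnm0E. Qed.

(* The short exact sequence 0 -> S_sigma(-Au) -> S/J -> S/J' -> 0. *)
Lemma loc_coh_zero_extension J J' x i p :
  supp_closed J -> supp_closed J' ->
  (forall w, in_spair x w -> ~ J 'X_[w]) ->
  (forall w, J' 'X_[w] <-> J 'X_[w] \/ in_spair x w) ->
  coh0 (face_ideal k x.2) i (p - mdegA A x.1) -> coh0 J' i p -> coh0 J i p.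
Proof.
case: x => u sigma /= cJ cJ' NJ J'E.
(* For [l] outside [sigma], the monomial with exponent [u + U_(l)] lies in [J'] as a multiple of a
   monomial of [J'], but not in the pair, hence it lies in [J]. *)
have faceJ g : face_ideal k sigma g -> J ('X_[u] * g).
  apply: (@ideal_gen_sub _ _ _ (ideal_colon J 'X_[u])) => _ [l lN ->] /=.
  have /J'E : J' 'X_[u + U_(l)].
    rewrite addmC mpolyXD; apply/ideal_memM/J'E; right.
    exact: in_spair_self (u, sigma).
  rewrite mpolyXD => -[] // [v [vs /addmI e]].
  by move: lN; rewrite vs // -e mnm1E eqxx.
(* A monomial of [g] supported on [sigma] would put an element of the pair into [J]. *)
have Jface g : J ('X_[u] * g) -> face_ideal k sigma g.
  move=> Jg; apply: ideal_mem_supp => w wg.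
  have Jw : J 'X_[u + w].
    apply: cJ Jg _; rewrite mulrC (perm_mem (msuppMX _ _)).
    exact: map_f.
  apply: contrapT => Nw; apply: NJ Jw; exists w; split=> // l wl /=.
  by apply: contrapT => /negP lN; apply: Nw; apply: face_ideal_mem lN wl.
have JJ' g : J g -> J' (1 * g).
  rewrite mul1r => Jg; apply: ideal_mem_supp => w wg.
  by apply/J'E; left; apply: cJ wg.
pose phi : {linear quot_mod (face_ideal k sigma) -> quot_mod J} :=
  HB.pack (quot_mul J 'X_[u])
    (GRing.isLinear.Build _ _ _ _ _ (quot_mul_linear faceJ)).
pose psi : {linear quot_mod J -> quot_mod J'} :=
  HB.pack (quot_mul J' 1)
    (GRing.isLinear.Build _ _ _ _ _ (quot_mul_linear JJ')).
apply: (@loc_coh_zero_middle _ _ _ _ _ _ _ _ _ _ _ phi psi).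
- exact: quot_gr_graded.
- move=> y z; rewrite -[y]to_quotK -[z]to_quotK /phi /= !quot_mulE //.
  move/to_quotE; rewrite -mulrBr => /Jface e.
  exact/to_quotE.
- move=> q _ [f [hf ->]]; exists ('X_[u] * f); rewrite /phi /= quot_mulE //.
  by split=> //; apply: homogAM => //; apply: homogAX.
- move=> q _ [f [hf ->]]; exists f; rewrite /psi /= quot_mulE //.
  by rewrite mul1r.
- move=> q _ [f [hf ->]]; rewrite /psi /= quot_mulE // mul1r.
  move=> /to_quot_eq0 J'f.
  have inx w : w \in msupp f -> ~ J 'X_[w] -> in_spair (u, sigma) w.
    by move=> wf NJw; have /J'E[] := cJ' _ _ J'f wf.
  (* The monomials of [f] outside [J] all lie in the pair, so they are divisible by the monomial of
     [u], and [w - u] is a genuine difference; the quotient [g] is the preimage, and the rest of [f]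
     is in [J]. *)
  pose P w := `[< ~ J 'X_[w] >].
  pose g : S := \sum_(w <- msupp f | P w) f@_w *: 'X_[w - u].
  exists (to_quot _ g); last first.
    rewrite /phi /= quot_mulE //; apply/to_quotE.
    have -> : 'X_[u] * g = \sum_(w <- msupp f | P w) f@_w *: 'X_[w].
      rewrite mulr_sumr big_seq_cond [RHS]big_seq_cond.
      apply: eq_bigr => w /andP[wf /asboolP /(inx w wf)[v [_ ->]]] /=.
      by rewrite -scalerAr addmC addmK mulrC mpolyXD.
    rewrite [X in _ - X](mpolyE f) [X in _ - X](bigID P) /= opprD addNKr.
    rewrite -mulN1r; apply/ideal_memM/ideal_mem_sum => w _ /asboolPn /contrapT.
    by rewrite -mul_mpolyC; apply: ideal_memM.
  exists g; split=> //; rewrite /g big_seq_cond; apply: big_ind.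
  + exact: homogA0.
  + exact: homogAD.
  move=> w /andP[wf /asboolP /(inx w wf)[v [_ e]]]; apply: homogAZX.
  by rewrite -(hf w wf) e /= mdegAD addmC addmK addrC addKr.
- move=> q _ [f [hf ->]]; exists (to_quot J f); first by exists f.
  by rewrite /psi /= quot_mulE // mul1r.
Qed.

Lemma loc_coh_zero_filtration I (s : seq ('X_{1..n} * {set 'I_n})) i p :
  supp_closed I -> stanley_filtration I s ->
  (forall x, x \in s -> coh0 (face_ideal k x.2) i (p - mdegA A x.1)) ->
  coh0 I i p.
Proof.
move=> cI [dI dK] zs.
pose K j : ideal S :=
  ideal_add I (fun f => exists2 x, x \in drop j s & f = 'X_[x.1]).
have cK j : supp_closed (K j) by apply: ideal_add_supp_closed.
(* A monomial outside [I] lies in some pair, hence is a multiple of that pair's first monomial. *)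
have K0 f : K 0%N f.
  apply: ideal_mem_supp => w _; have [Iw|NIw] := pselect (I 'X_[w]).
    by apply: ideal_gen_mem; left.
  have [_ dI2 _] := dI; have /dI2[x xs [v [_ ->]]] := NIw.
  rewrite addmC mpolyXD; apply/ideal_memM/ideal_gen_mem; right.
  by exists x; rewrite ?drop0.
(* The filtration condition starts at 1; at 0 the ideal is the whole ring and the empty list
   decomposes the zero quotient. *)
have {}dK j : (j <= size s)%N -> stanley_decomposition (K j) (take j s).
  case: j => [_|j lt]; last exact: dK.
  by rewrite take0; split=> // w; split=> [[]|[]].
suff zK j : (j <= size s)%N -> coh0 (K j) i p.
  have -> : I = K (size s).
    apply: ideal_ext => f; split=> [If|]; first by apply: ideal_gen_mem; left.
    by apply: ideal_gen_sub => g [] // [x]; rewrite drop_size.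
  exact: zK.
elim: j => [_|j IH lt].
  apply: loc_coh_zero_trivial; first exact: quot_gr_graded.
  move=> T _ _ y; rewrite -(fracK y); apply/frac_eq0; exists 0%N.
  rewrite scale1r; move: (generic_quotient.repr y).1 => m.
  by rewrite -[m]to_quotK; apply/to_quot_eq0.
have x0 : 'X_{1..n} * {set 'I_n} by case: (s) lt.
pose x := nth x0 s j.
have xs : x \in s by apply: mem_nth.
have [uK KE Kdisj] := dK _ lt; have [_ KjE _] := dK _ (ltnW lt).
rewrite (take_nth x0 lt) -/x in uK KE Kdisj.
move: uK; rewrite rcons_uniq => /andP[xN _].
apply: loc_coh_zero_extension (zs x xs) (IH (ltnW lt)) => // w.
  by move=> xw; apply/KE; exists x => //; rewrite mem_rcons mem_head.
(* The complements of [K j.+1] and [K j] are covered by the first [j.+1] and the first [j] pairs, so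
   the difference is the pair [x]. *)
split=> [Kw|[Kw|xw]].
- have [|NK] := pselect (K j.+1 'X_[w]); [by left|right].
  have /KE[y] := NK; rewrite mem_rcons inE => /orP[/eqP-> //|yj yw].
  suff : ~ K j 'X_[w] by [].
  by apply/KjE; exists y.
- apply: contrapT => /KjE[y yj yw].
  suff : ~ K j.+1 'X_[w] by [].
  by apply/KE; exists y => //; rewrite mem_rcons inE yj orbT.
(* Otherwise an earlier pair would meet [x]; disjointness identifies the two, against the absence of
   repetitions. *)
apply: contrapT => /KjE[y yj yw]; move: xN.
by rewrite (Kdisj x y w) ?yj // mem_rcons inE ?eqxx ?yj ?orbT.
Qed.

Hypothesis Delta_closed : forall sigma tau : {set 'I_n},
  sigma \in Delta -> tau \subset sigma -> tau \in Delta.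

(** No [tau] in [Delta] contains the complement of [sigma], so some variable outside [sigma] divides
    [irr_gen tau] and kills the face ring. For positive [i] every index set contains such a [tau],
    and all localizations are zero. *)
Lemma loc_coh_zero_torsion (sigma : {set 'I_n}) i p :
  ~: sigma \notin Delta -> (0 < i)%N -> coh0 (face_ideal k sigma) i p.
Proof.
move=> sN i0; apply: loc_coh_zero_trivial; first exact: quot_gr_graded.
move=> T sT cT y; have [tau tT] : exists tau, tau \in T.
  by apply/set0Pn; rewrite -card_gt0 cT.
have [l lN lt] : exists2 l, l \notin sigma & l \notin tau.
  have /subsetPn[l] : ~~ (~: sigma \subset tau).
    by apply: contra sN => /Delta_closed; apply; apply: (subsetP sT).
  by rewrite inE => lN lt; exists l.
have Fd : face_ideal k sigma (cech_den k T).
  rewrite (cech_denD1 _ tT) mulrC; apply: ideal_memM.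
  have -> : irr_gen k tau = \prod_(j in ~: tau | j != l) 'X_j * 'X_l.
    by rewrite /irr_gen (bigD1 l) ?inE //= mulrC.
  apply/ideal_memM/ideal_gen_mem.
  by exists l.
rewrite -(fracK y); apply/frac_eq0; exists 1%N.
move: (generic_quotient.repr y).1 => m; rewrite expr1 -[m]to_quotK to_quotZ.
by apply/to_quot_eq0; rewrite mulrC; apply: ideal_memM.
Qed.

(* Spending one unit of the budget [m sigma] for each factor [irr_gen sigma]
   is the pigeonhole argument for powers of the irrelevant ideal. *)
Lemma irrelevant_prod I (s : seq S) (m : {set 'I_n} -> nat) h :
  set0 \in Delta ->
  (forall sigma, sigma \in Delta -> I (h * irr_gen k sigma ^+ m sigma)) ->
  (\sum_(sigma in Delta) m sigma <= size s)%N ->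
  (forall g, g \in s -> irrelevant_ideal k Delta g) ->
  I (h * \prod_(g <- s) g).
Proof.
move=> D0; elim: s m h => [|g s IH] m h Im le Bs.
  (* The budget is exhausted, so the premise at the empty face already says that [h] is in [I]. *)
  rewrite big_nil mulr1; move: le (Im _ D0).
  by rewrite leqn0 sum_nat_eq0 => /forall_inP/(_ _ D0)/eqP->; rewrite mulr1.
rewrite big_cons; have [t [Gt ->]] := Bs g (mem_head _ _).
rewrite mulr_suml mulr_sumr; apply: ideal_mem_sum => -[a b] /= abt _.
have [sigma sD /= ->] := Gt _ abt.
rewrite -(mulrA a) mulrCA (mulrA h); apply: ideal_memM.
have [m0|m0] := posnP (m sigma).
  move: (Im _ sD); rewrite m0 mulr1 => Ih.
  by rewrite -mulrA mulrC; apply: ideal_memM.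
apply: (IH (fun tau => if tau == sigma then (m sigma).-1 else m tau)).
- move=> tau tD; case: eqP => [->|_].
    by rewrite -mulrA -exprS prednK //; apply: Im.
  by rewrite mulrAC mulrC; apply/ideal_memM/Im.
- move: le; rewrite (bigD1 sigma) //= [X in (X <= _)%N -> _]addnC.
  rewrite [X in _ -> (X <= _)%N](bigD1 sigma) //= eqxx.
  rewrite -{1}(prednK m0) addnS ltnS addnC; congr (_ <= _)%N.
  by congr addn; apply: eq_bigr => tau /andP[_ /negPf->].
by move=> b' b's; apply: Bs; rewrite inE b's orbT.
Qed.

(** A cocycle of degree 0 is the class of some [f] that a power of each generator sends into [I].
    Then a power of the irrelevant ideal does so too, and saturation puts [f] in [I]. *)
Lemma loc_coh_zero_saturated I p : set0 \in Delta ->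
  saturated I (irrelevant_ideal k Delta) -> coh0 I 0 p.
Proof.
(* Any cochain serves as witness: nothing lies below degree 0, and what remains is [c set0 = 0]. *)
move=> D0 satI c [_ dc]; exists c; split=> T sT //.
move=> /eqP; rewrite cards_eq0 => /eqP->.
rewrite /cech_diff big_set0.
have cE := fracK (c set0).
move: (generic_quotient.repr (c set0)) cE => [m t] /= cE.
rewrite -(to_quotK m) in cE; move: (generic_quotient.repr m) cE => f cE.
rewrite -cE; apply/frac_eq0; exists 0%N; rewrite scale1r; apply/to_quot_eq0.
have killed (sigma : {set 'I_n}) : sigma \in Delta ->
    exists j, I (f * irr_gen k sigma ^+ j).
  move=> sD; have := dc [set sigma].
  rewrite sub1set cards1 => /(_ sD erefl).
  rewrite /cech_diff big_set1.
  have -> : [set sigma] :\ sigma = set0 by apply/setP => u; rewrite !inE andNb.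
  rewrite -cE loc_mapE; last by rewrite /cech_den big_set1 big_set0 mulr1.
  have -> : cech_pos sigma [set sigma] = 0%N.
    apply/eqP; rewrite cards_eq0; apply/eqP/setP => u; rewrite !inE.
    by case: eqP => // ->; rewrite ltnn.
  rewrite mulr1z => /frac_eq0[j]; rewrite /cech_den big_set1.
  rewrite (to_quotZ I _ f) to_quotZ.
  (* The exponent [t] comes from the denominator through [loc_map], and [j] from the vanishing of
     the resulting fraction. *)
  move=> /to_quot_eq0 Ij; exists (j + t)%N.
  by rewrite exprD mulrC -mulrA.
pose N sigma := if pselect (sigma \in Delta) is left sD
  then projT1 (cid (killed sigma sD)) else 0%N.
(* With this many factors, some generator must use up its exponent [N sigma]. *)
apply/satI; exists (\sum_(sigma in Delta) N sigma)%N.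
apply: (@ideal_gen_sub _ _ _ (ideal_colon I f)) => _ [s [sz Bs ->]] /=.
apply: (irrelevant_prod (m := N) D0 _ _ Bs); last by rewrite sz.
by move=> sigma sD; rewrite /N; case: pselect => // sD'; case: cid.
Qed.

End Filtration.

(** * From vanishing in single degrees to regularity *)

Theorem theorem4p1 (k : fieldType) (R : realType) (n d r e : nat)
    (b : 'M[int]_(n, d)) (Delta : {set {set 'I_n}})
    (A : 'M[int]_(r, n)) (c : 'I_e -> 'cV[int]_r)
    (hfan : smooth_projective_fan b Delta R)
    (hr : r = (n - d)%N)
    (hA : exact_seq b A)
    (hc : hilbert_basis A Delta c)
    (I : ideal {mpoly k[n]}) (hI : monomial_ideal I)
    (s : seq ('X_{1..n} * {set 'I_n})) (hs : stanley_filtration I s) :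
  (forall q : 'cV[int]_r,
     (forall x, x \in s ->
        translate (mdegA A x.1) (reg_face k A Delta c x.2) q) ->
     reg_quot A Delta c I q) /\
  (saturated I (irrelevant_ideal k Delta) ->
   forall q : 'cV[int]_r,
     (forall x, x \in s -> ~: x.2 \in Delta ->
        translate (mdegA A x.1) (reg_face k A Delta c x.2) q) ->
     reg_quot A Delta c I q).
Proof.
have cI := monomial_ideal_supp_closed hI.
(* The twist by the degree of a pair's monomial undoes the translation of the regularity region. *)
have cancel_deg (a x y z : 'cV[int]_r) : a + x + y + z - a = x + y + z.
  by apply/eqP; rewrite subr_eq [eqbRHS]addrC !addrA.
split=> [q hq|satI q hq]; split.
- move=> i i0 l sl p Kp; apply: loc_coh_zero_filtration hs _ => // x.
  move=> /hq[q' [reg _] ->]; have := reg i i0 l sl p Kp.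
  by rewrite cancel_deg.
- move=> j p Kp; apply: loc_coh_zero_filtration hs _ => // x.
  move=> /hq[q' [_ reg] ->]; have := reg j p Kp.
  by rewrite cancel_deg.
(* In positive degrees, pairs whose complement is a face use the hypothesis on [q]; the others are
   torsion. *)
- move=> i i0 l sl p Kp; apply: loc_coh_zero_filtration hs _ => // x xs.
  have [xD|xN] := boolP (~: x.2 \in Delta); last first.
    by apply: loc_coh_zero_torsion => //; exact: fan_complex hfan.
  have [q' [reg _] ->] := hq x xs xD; have := reg i i0 l sl p Kp.
  by rewrite cancel_deg.
move=> j p Kp; apply: loc_coh_zero_saturated => //; exact: fan_zero hfan.
Qed.
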